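(* Let \(X\subseteq\operatorname{Homeo}_+(I)\) be a (possibly infinite) geometrically fast set, with the bumps used in \(X\) equipped with a marking witnessing geometric fastness, and let \(E\) be a set of bumps which is extraneous in \(X\) (as witnessed by some interval \(J\)). Then the map \(g\mapsto g/E\) (\(g\in X\)) extends to an isomorphism between \(\langle X\rangle\) and \(\langle X/E\rangle\).
   Context: \(I=[0,1]\); homeomorphisms act on the right. Support \(\operatorname{supt}(f)=\{t:tf\neq t\}\). A left (right) transition point of \(f\) is \(t\notin\operatorname{supt}(f)\) such that \((t,t+\epsilon)\) (resp. \((t-\epsilon,t)\)) meets \(\operatorname{supt}(f)\) for every \(\epsilon>0\). A bump is an element with one orbital (connected component of support), positive if \(ta>t\) on its support. A positive bump \(a\) is used in \(f\) if \(f\) agrees with \(a\) or \(a^{-1}\) on \(\operatorname{supt}(a)\); used in \(X\) if used in some \(f\in X\). \(X\) is geometrically proper if no point is a left transition point of two distinct elements of \(X\), nor a right transition point of two distinct elements. A marking of the set \(A\) of bumps used in \(X\) assigns each \(a\) a marker \(t\in\operatorname{supt}(a)\); the feet of \(a\) (support \((x,y)\)) are \((x,t)\) and \([ta,y)\); the feet of \(g\in X\) are the feet of the bumps used in \(g\). \(X\) is geometrically fast if it is geometrically proper and the marking makes all feet of \(A\) pairwise disjoint. A bump in \(A\) is isolated if its support contains no transition point of any element of \(A\). For \(f\in\operatorname{Homeo}_+(I)\) and a set \(E\) of positive bumps, \(f/E\) agrees with \(f\) on \(I\setminus\bigcup\{\operatorname{supt}(a): a\in E \text{ used in } f\}\)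 and is the identity elsewhere; \(X/E=\{f/E: f\in X\}\). \(E\) is extraneous in \(X\) as witnessed by an interval \(J\subseteq I\) if for some \(f\in X\): every element of \(E\) is an isolated bump used in \(f\) with support contained in \(J\); some bump used in \(f\) and not in \(E\) has a foot contained in \(J\); and \(J\) is disjoint from the feet of all \(g\in X\setminus\{f\}\). *)

(* Defs.v *)
From Stdlib Require Import Reals Lra ClassicalEpsilon.
Open Scope R_scope.

(* Elements of Homeo_+(I), I = [0,1], are represented as functions R -> R that
   are continuous, strictly increasing, and the identity outside (0,1).
   Homeomorphisms act on the right: t(fg) = (tf)g, i.e. fg = g o f. *)
Definition homeo (f : R -> R) : Prop :=
  continuity f /\
  (forall s t, s < t -> f s < f t) /\
  (forall t, t <= 0 \/ 1 <= t -> f t = t).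

(* product in the right-action convention *)
Definition mul (f g : R -> R) : R -> R := fun t => g (f t).

Definition supt (f : R -> R) (t : R) : Prop := f t <> t.

Definition left_tp (f : R -> R) (t : R) : Prop :=
  ~ supt f t /\ forall eps, 0 < eps -> exists s, t < s < t + eps /\ supt f s.

Definition right_tp (f : R -> R) (t : R) : Prop :=
  ~ supt f t /\ forall eps, 0 < eps -> exists s, t - eps < s < t /\ supt f s.

Definition supp_iv (a : R -> R) (x y : R) : Prop :=
  forall t, supt a t <-> x < t < y.

Definition bump (a : R -> R) : Prop :=
  homeo a /\ exists x y, x < y /\ supp_iv a x y.

Definition pos_bump (a : R -> R) : Prop :=
  bump a /\ forall t, supt a t -> t < a t.

Definition used (a f : R -> R) : Prop :=
  pos_bump a /\
  ((forall t, supt a t -> f t = a t) \/ (forall t, supt a t -> a (f t) = t)).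

Definition usedX (X : (R -> R) -> Prop) (a : R -> R) : Prop :=
  exists f, X f /\ used a f.

Definition geom_proper (X : (R -> R) -> Prop) : Prop :=
  (forall f g t, X f -> X g -> left_tp f t -> left_tp g t -> f = g) /\
  (forall f g t, X f -> X g -> right_tp f t -> right_tp g t -> f = g).

Definition in_foot (m : (R -> R) -> R) (a : R -> R) (side : bool) (t : R) : Prop :=
  exists x y, supp_iv a x y /\
    (if side then x < t < m a else a (m a) <= t < y).

Definition geom_fast (X : (R -> R) -> Prop) (m : (R -> R) -> R) : Prop :=
  geom_proper X /\
  (forall a, usedX X a -> supt a (m a)) /\
  (forall a b sa sb t, usedX X a -> usedX X b -> (a <> b \/ sa <> sb) ->
     ~ (in_foot m a sa t /\ in_foot m b sb t)).

Definition foot_of (m : (R -> R) -> R) (g : R -> R) (t : R) : Prop :=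
  exists a side, used a g /\ in_foot m a side t.

Definition isolated (X : (R -> R) -> Prop) (a : R -> R) : Prop :=
  usedX X a /\
  forall b t, usedX X b -> (left_tp b t \/ right_tp b t) -> ~ supt a t.

Definition interval (J : R -> Prop) : Prop :=
  forall s t u, J s -> J u -> s <= t <= u -> J t.

Definition extraneous (X : (R -> R) -> Prop) (m : (R -> R) -> R)
    (E : (R -> R) -> Prop) (J : R -> Prop) : Prop :=
  interval J /\ (forall t, J t -> 0 <= t <= 1) /\
  exists f, X f /\
    (forall a, E a -> isolated X a /\ used a f /\ (forall t, supt a t -> J t)) /\
    (exists b, used b f /\ ~ E b /\
       exists side, forall t, in_foot m b side t -> J t) /\
    (forall g t, X g -> g <> f -> foot_of m g t -> ~ J t).

Definition quot (f : R -> R) (E : (R -> R) -> Prop) : R -> R :=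
  fun t => if excluded_middle_informative
                (exists a, E a /\ used a f /\ supt a t)
           then t else f t.

Definition quotset (X : (R -> R) -> Prop) (E : (R -> R) -> Prop) : (R -> R) -> Prop :=
  fun h => exists f, X f /\ h = quot f E.

Inductive gen (X : (R -> R) -> Prop) : (R -> R) -> Prop :=
| gen_base f : X f -> gen X f
| gen_id : gen X (fun t => t)
| gen_mul f g : gen X f -> gen X g -> gen X (mul f g)
| gen_inv f h : gen X f -> (forall t, h (f t) = t /\ f (h t) = t) -> gen X h.

(* Main.v *)
(* A word w in X and the corresponding word w/E in X/E act alike outside the translates of
   U, the union of the supports of the bumps in E, so it suffices to compare them on U.
   The interval J contains U and a foot of a bump b outside E, and every bump used in some
   g <> f either misses J or contains it in a fundamental domain.  By ping-pong J is
   therefore moved as a single block: after reading w, every point s of U, and every s close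
   enough to the end of b in J, sits at (s f^k) u with the same exponent k and the same
   reduced word u in bumps outside E, while under w/E the points of U sit at s u.
   Applying this near the end of b, triviality of w or of w/E forces k = 0 and u to be
   empty, hence both words fix U pointwise. *)

Require Import Defs.
From Stdlib Require Import Reals Lra List Bool Classical ClassicalEpsilon FunctionalExtensionality.
Import ListNotations.
Open Scope R_scope.

(** * Bijections of the line and words *)

Definition bij (f : R -> R) : Prop :=
  (forall s t, f s = f t -> s = t) /\ (forall t, exists s, f s = t).

Definition incr (f : R -> R) : Prop := forall s t, s < t -> f s < f t.

(** Total by choice; a genuine inverse only when [f] is a bijection. *)
Definition inv (f : R -> R) : R -> R :=
  fun t => epsilon (inhabits 0) (fun s => f s = t).

Lemma inv_r f t : bij f -> f (inv f t) = t.
Proof.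
  intros [_ Hs]. exact (epsilon_spec (inhabits 0) (fun s => f s = t) (Hs t)).
Qed.

Lemma inv_l f t : bij f -> inv f (f t) = t.
Proof. intros H. apply (proj1 H). now apply inv_r. Qed.

Lemma inv_eq f s t : bij f -> f s = t -> inv f t = s.
Proof. intros H <-. now apply inv_l. Qed.

Lemma incr_le f s t : incr f -> s <= t -> f s <= f t.
Proof. intros H [L | ->]; [left; auto | right; auto]. Qed.

Lemma incr_lt_cancel f s t : incr f -> f s < f t -> s < t.
Proof.
  intros H L. destruct (Rlt_or_le s t) as [|L']; auto.
  apply (incr_le f) in L'; auto. lra.
Qed.

Lemma incr_inj f s t : incr f -> f s = f t -> s = t.
Proof.
  intros H e. destruct (Rtotal_order s t) as [L | [? | L]]; auto; apply H in L; lra.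
Qed.

Lemma inv_incr f : bij f -> incr f -> incr (inv f).
Proof.
  intros B H s t L. apply (incr_lt_cancel f); auto. now rewrite !inv_r.
Qed.

Lemma bij_inv f : bij f -> bij (inv f).
Proof.
  intros B. split.
  - intros s t e. rewrite <- (inv_r f s), <- (inv_r f t) by auto. now rewrite e.
  - intros t. exists (f t). now apply inv_l.
Qed.

(** The preimages of [f t - eps] and [f t + eps] bound a neighbourhood of [t] that [f] keeps within
    [eps] of [f t]. *)
Lemma incr_surj_continuity f : incr f -> (forall t, exists s, f s = t) -> continuity f.
Proof.
  intros H S t eps He.
  destruct (S (f t - eps)) as [s1 E1]. destruct (S (f t + eps)) as [s2 E2].
  assert (s1 < t) by (apply (incr_lt_cancel f); auto; lra).
  assert (t < s2) by (apply (incr_lt_cancel f); auto; lra).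
  exists (Rmin (t - s1) (s2 - t)). split.
  - apply Rmin_pos; lra.
  - intros x [_ D]. simpl in *. unfold Rdist in *.
    assert (D1 := Rmin_l (t - s1) (s2 - t)). assert (D2 := Rmin_r (t - s1) (s2 - t)).
    assert (- (t - s1) < x - t < s2 - t) by (apply Rabs_def2 in D; lra).
    apply Rabs_def1.
    + assert (f x < f s2) by (apply H; lra). lra.
    + assert (f s1 < f x) by (apply H; lra). lra.
Qed.

Lemma homeo_bij f : homeo f -> bij f.
Proof.
  intros (C & I & O). split.
  - intros s t. now apply incr_inj.
  - intros t. destruct (Rle_or_lt t 0). { exists t. apply O; auto. }
    destruct (Rle_or_lt 1 t). { exists t. apply O; auto. }
    assert (C' : continuity (f - (fun _ => t))%F).
    { apply continuity_minus; auto. apply continuity_const. intros ? ?; auto. }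
    destruct (IVT_cor (f - (fun _ => t))%F 0 1) as [z [_ Z]]; auto; try lra.
    + unfold minus_fct. rewrite (O 0), (O 1) by lra. nra.
    + exists z. unfold minus_fct in Z. lra.
Qed.

Lemma homeo_incr f : homeo f -> incr f.
Proof. now intros (_ & I & _). Qed.

(** * Words in generators and their values *)

Definition letter : Type := ((R -> R) * bool)%type.

Definition act (l : letter) : R -> R := if snd l then fst l else inv (fst l).

(* The head of a word acts last. *)
Fixpoint ev (w : list letter) (t : R) : R :=
  match w with
  | [] => t
  | l :: w' => act l (ev w' t)
  end.

Definition winv (w : list letter) : list letter :=
  rev (map (fun l => (fst l, negb (snd l))) w).

Definition bij_letters (w : list letter) : Prop := Forall (fun l => bij (fst l)) w.

Lemma act_bij l : bij (fst l) -> bij (act l).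
Proof. destruct l as [f []]; simpl; auto. apply bij_inv. Qed.

Lemma act_incr l : bij (fst l) -> incr (fst l) -> incr (act l).
Proof. destruct l as [f []]; simpl; auto. apply inv_incr. Qed.

Lemma act_negb f e t : bij f -> act (f, negb e) (act (f, e) t) = t.
Proof. intros B. destruct e; cbn; [now apply inv_l | now apply inv_r]. Qed.

Lemma ev_app w v t : ev (w ++ v) t = ev w (ev v t).
Proof. induction w as [|l w IH]; simpl; congruence. Qed.

Lemma ev_bij w : bij_letters w -> bij (ev w).
Proof.
  induction 1 as [|l w Hl _ [I S]]; simpl.
  - split; auto. intros t. now exists t.
  - apply act_bij in Hl. destruct Hl as [Il Sl]. split.
    + intros s t e. auto.
    + intros t. destruct (Sl t) as [r <-]. destruct (S r) as [s <-]. now exists s.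
Qed.

Lemma ev_incr w :
  Forall (fun l => bij (fst l) /\ incr (fst l)) w -> incr (ev w).
Proof.
  induction 1 as [|l w [Hb Hi] _ IH]; simpl.
  - now intros s t.
  - intros s t L. apply act_incr; auto.
Qed.

Lemma ev_winv_l w t : bij_letters w -> ev (winv w) (ev w t) = t.
Proof.
  intros H. revert t. induction H as [|[f e] w Hl _ IH]; intros t; auto.
  unfold winv in *. simpl. rewrite ev_app. cbn [ev]. rewrite act_negb; auto.
Qed.

Lemma ev_winv_r w t : bij_letters w -> ev w (ev (winv w) t) = t.
Proof.
  intros H. destruct (proj2 (ev_bij w H) t) as [s <-]. now rewrite ev_winv_l.
Qed.

Lemma Forall_winv (P : (R -> R) -> Prop) w :
  Forall (fun l => P (fst l)) w -> Forall (fun l => P (fst l)) (winv w).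
Proof.
  intros H. unfold winv. apply Forall_rev. apply Forall_map. exact H.
Qed.

(** Words allow a map given on generators to be extended letter by letter. *)
Lemma gen_words (X : (R -> R) -> Prop) :
  (forall f, X f -> bij f) ->
  forall h, gen X h <-> exists w, Forall (fun l => X (fst l)) w /\ ev w = h.
Proof.
  intros B h. split.
  - induction 1 as [f Hf | | f g _ (w & Hw & <-) _ (v & Hv & <-) | f h _ (w & Hw & <-) Hh].
    + exists [(f, true)]. split; auto.
    + exists []. split; auto.
    (* [mul f g] applies [f] first, so the word of [f] forms the tail. *)
    + exists (v ++ w). split.
      * apply Forall_app; auto.
      * extensionality t. apply ev_app.
    + exists (winv w). split.
      * now apply Forall_winv.
      * assert (Bw : bij_letters w) by (eapply Forall_impl; [|exact Hw]; simpl; auto).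
        extensionality t. apply (proj1 (ev_bij w Bw)). rewrite ev_winv_r; auto.
        symmetry. apply Hh.
  - intros (w & Hw & <-). induction Hw as [|[f e] w Hl _ IH].
    + apply gen_id.
    + change (ev ((f, e) :: w)) with (mul (ev w) (act (f, e))).
      apply gen_mul; auto. destruct e; cbn in *.
      * now apply gen_base.
      * apply gen_inv with f; [now apply gen_base|].
        intros t. split; [apply inv_l | apply inv_r]; auto.
Qed.

(** * Bumps and orbitals *)

Lemma supp_iv_unique a x y x' y' :
  x < y -> supp_iv a x y -> supp_iv a x' y' -> x = x' /\ y = y'.
Proof.
  intros L H H'.
  assert (K : forall t, x < t < y <-> x' < t < y').
  { intros t. rewrite <- (H t). apply H'. }
  assert (M := proj1 (K ((x + y) / 2)) ltac:(lra)).
  split.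
  - destruct (Rtotal_order x x') as [C | [C | C]]; auto; exfalso.
    + assert (Q := proj1 (K x') ltac:(lra)). lra.
    + assert (Q := proj2 (K x) ltac:(lra)). lra.
  - destruct (Rtotal_order y y') as [C | [C | C]]; auto; exfalso.
    + assert (Q := proj2 (K y) ltac:(lra)). lra.
    + assert (Q := proj1 (K y') ltac:(lra)). lra.
Qed.

Lemma used_bij a f : used a f -> bij a.
Proof. intros [[[H _] _] _]. now apply homeo_bij. Qed.

Lemma used_incr a f : used a f -> incr a.
Proof. intros [[[H _] _] _]. now apply homeo_incr. Qed.

Lemma used_supp a f : used a f -> exists x y, x < y /\ supp_iv a x y.
Proof. intros [[[_ H] _] _]. exact H. Qed.

Lemma supt_act a e t : bij a -> supt a t <-> supt a (act (a, e) t).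
Proof.
  intros B. unfold supt. destruct e; cbn; split; intros H C; apply H.
  - now apply (proj1 B).
  - now rewrite C.
  - rewrite inv_r in C by auto. rewrite C at 1. now apply inv_r.
  - rewrite inv_r by auto. symmetry. now apply inv_eq.
Qed.

Lemma supt_inv f e t : bij f -> supt f t <-> supt (act (f, e)) t.
Proof.
  intros B. destruct e; [reflexivity|]. unfold supt, act; cbn. split; intros H C; apply H.
  - rewrite <- C at 1. now apply inv_r.
  - now apply inv_eq.
Qed.

(** The sign [sg] records whether [f] agrees with [a] or with its inverse, and [eqb e sg] multiplies
    exponents. The case of [inv f] follows because [a] preserves its support. *)
Lemma used_act a f :
  bij f -> used a f ->
  exists sg, forall t e, supt a t -> act (f, e) t = act (a, eqb e sg) t.
Proof.
  intros Bf U. assert (Ba := used_bij _ _ U). destruct U as [_ [H | H]].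
  - exists true. intros t [] Ht; cbn; auto.
    assert (K : supt a (inv a t)) by exact (proj1 (supt_act a false t Ba) Ht).
    apply inv_eq; auto. rewrite H by auto. now apply inv_r.
  - exists false. intros t [] Ht; cbn.
    + symmetry. apply inv_eq; auto.
    + apply inv_eq; auto.
      assert (K : supt a (a t)) by exact (proj1 (supt_act a true t Ba) Ht).
      apply (proj1 Ba). now apply H.
Qed.

Lemma used_supt a f t : bij f -> used a f -> supt a t -> supt f t.
Proof.
  intros Bf U Ht. destruct (used_act a f Bf U) as [sg H].
  specialize (H t true Ht). cbn in H. unfold supt. rewrite H.
  assert (Ba := used_bij _ _ U).
  destruct sg; cbn; auto. intros C. apply Ht. rewrite <- C at 1. now apply inv_r.
Qed.

Lemma used_supt_act a f e t :
  bij f -> used a f -> supt a t <-> supt a (act (f, e) t).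
Proof.
  intros Bf U. destruct (used_act a f Bf U) as [sg H]. assert (Ba := used_bij _ _ U).
  assert (K : forall r e', supt a r -> supt a (act (f, e') r)).
  { intros r e' Hr. rewrite H by auto. now apply (proj1 (supt_act a (eqb e' sg) r Ba)). }
  split; auto. intros Ht. rewrite <- (act_negb f e t) by auto. auto.
Qed.

(** Both [f] and its inverse preserve the open interval [(x, y)]; by monotonicity, moving an
    endpoint would push interior points out of it or leave some without a preimage in it. *)
Lemma used_endpoints a f x y :
  homeo f -> used a f -> x < y -> supp_iv a x y -> f x = x /\ f y = y.
Proof.
  intros Hf U L S. assert (Bf := homeo_bij f Hf). assert (If := homeo_incr f Hf).
  assert (K : forall t, x < t < y -> x < f t < y).
  { intros t Ht. apply S. apply (proj1 (used_supt_act a f true t Bf U)). now apply S. }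
  assert (K' : forall t, x < t < y -> x < inv f t < y).
  { intros t Ht. apply S. apply (proj1 (used_supt_act a f false t Bf U)). now apply S. }
  set (mid := (x + y) / 2). assert (Hm : x < mid < y) by (unfold mid; lra).
  split.
  - destruct (Rtotal_order (f x) x) as [C | [C | C]]; auto; exfalso.
    + assert (x < inv f x) by (apply (incr_lt_cancel f); auto; rewrite inv_r; auto).
      destruct (Rlt_or_le (inv f x) y) as [C'|C'].
      * specialize (K (inv f x) ltac:(lra)). rewrite inv_r in K; auto. lra.
      * assert (f mid < f (inv f x)) by (apply If; lra).
        rewrite inv_r in *; auto. specialize (K mid Hm). lra.
    + set (r := Rmin (f x) mid). assert (r <= f x) by apply Rmin_l.
      assert (x < r) by (apply Rmin_glb_lt; lra). assert (r <= mid) by apply Rmin_r.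
      specialize (K' r ltac:(lra)). assert (f x < f (inv f r)) by (apply If; lra).
      rewrite inv_r in *; auto. lra.
  - destruct (Rtotal_order (f y) y) as [C | [C | C]]; auto; exfalso.
    + set (r := Rmax (f y) mid). assert (f y <= r) by apply Rmax_l.
      assert (r < y) by (apply Rmax_lub_lt; lra). assert (mid <= r) by apply Rmax_r.
      specialize (K' r ltac:(lra)). assert (f (inv f r) < f y) by (apply If; lra).
      rewrite inv_r in *; auto. lra.
    + assert (inv f y < y) by (apply (incr_lt_cancel f); auto; rewrite inv_r; auto).
      destruct (Rlt_or_le x (inv f y)) as [C'|C'].
      * specialize (K (inv f y) ltac:(lra)). rewrite inv_r in K; auto. lra.
      * assert (f (inv f y) < f mid) by (apply If; lra).
        rewrite inv_r in *; auto. specialize (K mid Hm). lra.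
Qed.

(** [f] fixes the ends of both supports and moves their interiors, so overlapping supports coincide;
    positivity then forces the same sign, hence the same values. *)
Lemma used_unique a b f p :
  homeo f -> used a f -> used b f -> supt a p -> supt b p -> a = b.
Proof.
  intros Hf Ua Ub Hap Hbp. assert (Bf := homeo_bij f Hf).
  destruct (used_supp a f Ua) as (x & y & L & S).
  destruct (used_supp b f Ub) as (x' & y' & L' & S').
  destruct (used_endpoints a f x y) as [Fx Fy]; auto.
  destruct (used_endpoints b f x' y') as [Fx' Fy']; auto.
  assert (Hp := proj1 (S p) Hap). assert (Hp' := proj1 (S' p) Hbp).
  assert (M : forall t, x < t < y -> f t <> t).
  { intros t Ht. apply (used_supt a f t); auto. now apply S. }
  assert (M' : forall t, x' < t < y' -> f t <> t).
  { intros t Ht. apply (used_supt b f t); auto. now apply S'. }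
  assert (x = x').
  { destruct (Rtotal_order x x') as [C | [C | C]]; auto; exfalso.
    - apply (M x'); auto; lra.
    - apply (M' x); auto; lra. }
  assert (y = y').
  { destruct (Rtotal_order y y') as [C | [C | C]]; auto; exfalso.
    - apply (M' y); auto; lra.
    - apply (M y'); auto; lra. }
  subst x' y'.
  assert (SS : forall t, supt a t <-> supt b t).
  { intros t. rewrite (S t), (S' t). reflexivity. }
  destruct (used_act a f Bf Ua) as [sa Ha]. destruct (used_act b f Bf Ub) as [sb Hb].
  assert (Ba := used_bij _ _ Ua). assert (Bb := used_bij _ _ Ub).
  assert (Pa := proj2 (proj1 Ua)). assert (Pb := proj2 (proj1 Ub)).
  (* With opposite signs [f] would move [p] both up and down. *)
  assert (Q : sa = sb).
  { assert (C := Ha p true Hap). rewrite (Hb p true Hbp) in C.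
    destruct sa, sb; auto; cbn in C; exfalso.
    - assert (K : supt b (inv b p)) by exact (proj1 (supt_act b false p Bb) Hbp).
      apply Pb in K. rewrite inv_r in K by auto. apply Pa in Hap. lra.
    - assert (K : supt a (inv a p)) by exact (proj1 (supt_act a false p Ba) Hap).
      apply Pa in K. rewrite inv_r in K by auto. apply Pb in Hbp. lra. }
  subst sb. extensionality t. destruct (Req_dec (a t) t) as [C | C].
  - destruct (Req_dec (b t) t) as [C' | C']; [congruence|].
    exfalso. now apply SS in C'.
  - assert (C' := proj1 (SS t) C).
    assert (D := Ha t sa C). rewrite (Hb t sa C') in D.
    now destruct sa; cbn in D.
Qed.

(** The ends are the nearest fixed points of [h] on either side of [p]; there are some, as [h] fixes
    0 and 1. *)
Lemma orbital_endpoints h p :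
  homeo h -> h p <> p ->
  exists x y, x < p < y /\ h x = x /\ h y = y /\ forall t, x < t < y -> h t <> t.
Proof.
  intros Hh Hp. assert (B := homeo_bij h Hh). assert (I := homeo_incr h Hh).
  destruct Hh as (_ & _ & O).
  assert (P01 : 0 < p < 1).
  { destruct (Rlt_or_le 0 p); [|exfalso; apply Hp, O; auto].
    destruct (Rlt_or_le p 1); [lra|exfalso; apply Hp, O; auto]. }
  destruct (completeness (fun t => t <= p /\ h t = t)) as [x [Ux Lx]].
  { exists p. intros t [Ht _]. auto. }
  { exists 0. split; [lra|apply O; lra]. }
  (* The infimum of the fixed points above [p] is obtained as a supremum after negation. *)
  destruct (completeness (fun t => p <= - t /\ h (- t) = - t)) as [y' [Uy Ly]].
  { exists (- p). intros t [Ht _]. lra. }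
  { exists (- 1). replace (- - 1) with 1 by lra. split; [lra|apply O; lra]. }
  (* An increasing bijection preserves the fixed-point set, hence fixes its supremum. *)
  assert (Fx : h x = x).
  { assert (x <= h x).
    { apply Lx. intros t [Ht Et]. rewrite <- Et. apply incr_le; [exact I | apply Ux; auto]. }
    assert (Q : x <= inv h x).
    { apply Lx. intros t [Ht Et]. replace t with (inv h t) by now apply inv_eq.
      apply incr_le; [now apply inv_incr|]. apply Ux; auto. }
    apply (incr_le h) in Q; auto. rewrite inv_r in Q by auto. lra. }
  assert (Fy : h (- y') = - y').
  { assert (h (- y') <= - y').
    { assert (y' <= - h (- y')); [|lra]. apply Ly. intros t [Ht Et].
      assert (t <= y') by (apply Uy; auto).
      assert (h (- y') <= h (- t)) by (apply incr_le; auto; lra). lra. }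
    assert (Q : inv h (- y') <= - y').
    { assert (y' <= - inv h (- y')); [|lra]. apply Ly. intros t [Ht Et].
      assert (t <= y') by (apply Uy; auto).
      assert (inv h (- y') <= inv h (- t)) by (apply incr_le; [now apply inv_incr|lra]).
      rewrite (inv_eq h (- t) (- t)) in *; auto. lra. }
    apply (incr_le h) in Q; auto. rewrite inv_r in Q by auto. lra. }
  assert (x <= p) by (apply Lx; intros t [Ht _]; auto).
  assert (y' <= - p) by (apply Ly; intros t [Ht _]; lra).
  assert (x <> p) by (intros ->; auto).
  assert (- y' <> p) by (intros C; rewrite C in Fy; auto).
  exists x, (- y'). repeat split; auto; try lra.
  intros t Ht Et. destruct (Rle_or_lt t p) as [C | C].
  - assert (t <= x) by (apply Ux; auto). lra.
  - assert (- t <= y') by (apply Uy; rewrite Ropp_involutive; split; auto; lra). lra.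
Qed.

(** The bump is [h] or its inverse, whichever moves [p] to the right, cut down to the orbital of [p]
    and extended by the identity. *)
Lemma orbital_bump h p : homeo h -> supt h p -> exists d, used d h /\ supt d p.
Proof.
  intros Hh Hp. assert (B := homeo_bij h Hh). assert (I := homeo_incr h Hh).
  destruct (orbital_endpoints h p Hh Hp) as (x & y & Hxy & Fx & Fy & M).
  (* [h - id] keeps its sign on the orbital: a sign change would yield a fixed point there. *)
  assert (Sgn : forall s t, x < s < y -> x < t < y -> s < h s -> t < h t).
  { intros s t Hs Ht L. destruct (Rlt_or_le t (h t)) as [|C]; auto. exfalso.
    assert (Cc : continuity (h - id)%F).
    { apply continuity_minus; [apply Hh|]. apply derivable_continuous, derivable_id. }
    unfold minus_fct, id in Cc.
    destruct (Rle_or_lt s t) as [D | D].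
    - destruct (IVT_cor _ s t Cc D) as [z [Hz Z]]; [nra|]. apply (M z); lra.
    - destruct (IVT_cor _ t s Cc) as [z [Hz Z]]; [lra|nra|]. apply (M z); lra. }
  set (e := if Rlt_dec p (h p) then true else false).
  set (k := act (h, e)).
  assert (Bk : bij k) by now apply act_bij.
  assert (Ik : incr k) by now apply act_incr.
  assert (Kx : k x = x) by (unfold k; destruct e; cbn; auto; now apply inv_eq).
  assert (Ky : k y = y) by (unfold k; destruct e; cbn; auto; now apply inv_eq).
  assert (Kin : forall t, x < t < y -> x < k t < y).
  { intros t Ht. assert (k x < k t < k y) by (split; apply Ik; lra). lra. }
  assert (Kpos : forall t, x < t < y -> t < k t).
  { intros t Ht. unfold k, e. destruct (Rlt_dec p (h p)) as [C | C]; cbn.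
    - apply Sgn with p; auto.
    - apply (incr_lt_cancel h); auto. rewrite inv_r by auto.
      destruct (Rtotal_order (h t) t) as [|[Q|Q]]; auto; exfalso.
      + now apply (M t).
      + apply C. apply Sgn with t; auto. }
  set (d := fun t => if Rlt_dec x t then if Rlt_dec t y then k t else t else t).
  assert (Din : forall t, x < t < y -> d t = k t).
  { intros t Ht. unfold d. destruct (Rlt_dec x t), (Rlt_dec t y); auto; lra. }
  assert (Dout : forall t, ~ x < t < y -> d t = t).
  { intros t Ht. unfold d. destruct (Rlt_dec x t), (Rlt_dec t y); auto; lra. }
  assert (Dec : forall t, x < t < y \/ ~ x < t < y).
  { intros t. destruct (Rlt_dec x t), (Rlt_dec t y); lra. }
  assert (Sd : supp_iv d x y).
  { intros t. unfold supt. destruct (Dec t) as [C | C].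
    - rewrite Din by auto. specialize (Kpos t C). split; auto. intros _. lra.
    - rewrite Dout by auto. split; intros; lra. }
  (* An orbital reaching beyond [[0,1]] would contain a point that [h] fixes. *)
  assert (X01 : 0 <= x /\ y <= 1).
  { destruct Hh as (_ & _ & O). split.
    - destruct (Rle_or_lt 0 x); auto. exfalso.
      apply (M (Rmin ((x + p) / 2) 0)).
      + split; [apply Rmin_glb_lt; lra|].
        assert (Q := Rmin_l ((x + p) / 2) 0). lra.
      + apply O. left. apply Rmin_r.
    - destruct (Rle_or_lt y 1); auto. exfalso.
      apply (M (Rmax ((y + p) / 2) 1)).
      + split; [|apply Rmax_lub_lt; lra].
        assert (Q := Rmax_l ((y + p) / 2) 1). lra.
      + apply O. right. apply Rmax_r. }
  assert (Id : incr d).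
  { intros s t L. destruct (Dec s) as [Cs | Cs], (Dec t) as [Ct | Ct].
    - rewrite !Din by auto. now apply Ik.
    - rewrite Din, Dout by auto. specialize (Kin s Cs). lra.
    - rewrite Dout, Din by auto. specialize (Kin t Ct). lra.
    - now rewrite !Dout by auto. }
  assert (Hd : homeo d).
  { split; [|split]; auto.
    - apply incr_surj_continuity; auto. intros t. destruct (Dec t) as [C | C].
      + exists (inv k t). rewrite Din; [now apply inv_r|].
        split; apply (incr_lt_cancel k); auto; rewrite inv_r by auto; lra.
      + exists t. now apply Dout.
    - intros t Ht. apply Dout. lra. }
  exists d. split; [split; [split; [split|]|]|].
  - exact Hd.
  - exists x, y. split; auto. lra.
  - intros t Ht. apply Sd in Ht. rewrite Din by auto. now apply Kpos.
  - unfold k, e in *. destruct (Rlt_dec p (h p)); [left | right]; intros t Ht;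
      apply Sd in Ht.
    + symmetry. now apply Din.
    + rewrite Din.
      * cbn. now apply inv_l.
      * assert (h x < h t < h y) by (split; apply I; lra). lra.
  - now apply Sd.
Qed.

(** * Excision of extraneous bumps *)

Section Excision.

Variables (X : (R -> R) -> Prop) (m : (R -> R) -> R) (E : (R -> R) -> Prop)
  (J : R -> Prop) (f b : R -> R) (side : bool).
Hypothesis HX : forall g, X g -> homeo g.
Hypothesis Hfast : geom_fast X m.
Hypothesis HJ : interval J.
Hypothesis Hf : X f.
Hypothesis HE : forall a, E a -> used a f /\ forall t, supt a t -> J t.
Hypothesis Hb : used b f.
Hypothesis HbE : ~ E b.
Hypothesis HbJ : forall t, in_foot m b side t -> J t.
Hypothesis HgJ : forall g t, X g -> g <> f -> foot_of m g t -> ~ J t.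

Definition U (t : R) : Prop := exists a, E a /\ supt a t.

Definition qmap (w : list letter) : list letter :=
  map (fun l => (quot (fst l) E, snd l)) w.

Definition over (w : list letter) : Prop := Forall (fun l => X (fst l)) w.

(** * Quotients of generators by [E] *)

Lemma X_bij g : X g -> bij g.
Proof. intros H. now apply homeo_bij, HX. Qed.

(** The left end of the support of [a] is a left transition point of every element using [a], so
    geometric properness applies. *)
Lemma used_same a g h : X g -> X h -> used a g -> used a h -> g = h.
Proof.
  intros Xg Xh Ug Uh. destruct (used_supp a g Ug) as (x & y & L & S).
  assert (T : forall k, X k -> used a k -> left_tp k x).
  { intros k Xk Uk. split.
    - intros C. apply C. now apply (used_endpoints a k x y); auto.
    - intros eps He. exists (x + Rmin (eps / 2) ((y - x) / 2)).
      assert (A1 := Rmin_l (eps / 2) ((y - x) / 2)).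
      assert (A2 := Rmin_r (eps / 2) ((y - x) / 2)).
      assert (0 < Rmin (eps / 2) ((y - x) / 2)) by (apply Rmin_pos; lra).
      split; [lra|]. apply (used_supt a k); auto.
      + now apply X_bij.
      + apply S. lra. }
  destruct Hfast as [[P _] _]. apply (P g h x); auto.
Qed.

Lemma used_f_only a g : X g -> g <> f -> used a g -> ~ E a.
Proof.
  intros Xg N Ug Ea. apply N. apply (used_same a); auto. now apply HE.
Qed.

Lemma quot_other g : X g -> g <> f -> quot g E = g.
Proof.
  intros Xg N. extensionality t. unfold quot.
  destruct (excluded_middle_informative _) as [(a & Ea & Ua & _) | _]; auto.
  exfalso. now apply (used_f_only a g).
Qed.

Lemma quot_in t : U t -> quot f E t = t.
Proof.
  intros (a & Ea & Sa). unfold quot.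
  destruct (excluded_middle_informative _) as [_ | N]; auto.
  exfalso. apply N. exists a. repeat split; auto; now apply HE.
Qed.

Lemma quot_out t : ~ U t -> quot f E t = f t.
Proof.
  intros N. unfold quot.
  destruct (excluded_middle_informative _) as [(a & Ea & _ & Sa) | _]; auto.
  exfalso. apply N. now exists a.
Qed.

Lemma U_act e t : U t <-> U (act (f, e) t).
Proof.
  split; intros (a & Ea & Sa); exists a; split; auto; destruct (HE a Ea) as [Ua _];
    now apply (used_supt_act a f e t (X_bij f Hf) Ua).
Qed.

(** [f] preserves [U] and its complement, so replacing [f] by the identity on [U] glues two
    bijections. *)
Lemma quot_bij g : X g -> bij (quot g E).
Proof.
  intros Xg. destruct (classic (g = f)) as [-> | N].
  2: { rewrite quot_other by auto. now apply X_bij. }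
  assert (Bf := X_bij f Hf). split.
  - intros s t e. destruct (classic (U s)) as [Us | Us], (classic (U t)) as [Ut | Ut].
    + now rewrite !quot_in in e.
    + exfalso. rewrite quot_in, quot_out in e by auto. apply Ut.
      apply (U_act true). cbn. now rewrite <- e.
    + exfalso. rewrite quot_out, quot_in in e by auto. apply Us.
      apply (U_act true). cbn. now rewrite e.
    + rewrite !quot_out in e by auto. now apply (proj1 Bf).
  - intros t. destruct (classic (U t)) as [Ut | Ut].
    + exists t. now apply quot_in.
    + exists (inv f t). rewrite quot_out; [now apply inv_r|].
      intros C. apply Ut. now apply (U_act false) in C.
Qed.

Lemma act_quot_in e t : U t -> act (quot f E, e) t = t.
Proof.
  intros Ut. assert (Q := quot_in t Ut). destruct e; cbn; auto.
  apply inv_eq; auto. now apply quot_bij.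
Qed.

Lemma act_quot_out g e t : X g -> ~ U t -> act (quot g E, e) t = act (g, e) t.
Proof.
  intros Xg Ut. destruct (classic (g = f)) as [-> | N]; [|now rewrite quot_other].
  destruct e; cbn; [now apply quot_out|].
  apply inv_eq; [now apply quot_bij|].
  rewrite quot_out; [apply inv_r; now apply X_bij|].
  intros C. apply Ut. now apply (U_act false).
Qed.

Lemma act_fix g e t : bij g -> g t = t -> act (g, e) t = t.
Proof. intros B H. destruct e; cbn; auto. now apply inv_eq. Qed.

Lemma act_quot_fix g e t : X g -> g t = t -> act (quot g E, e) t = t.
Proof.
  intros Xg Ft. apply act_fix; [now apply quot_bij|].
  unfold quot. now destruct (excluded_middle_informative _).
Qed.

(** Distinct bumps used in [f] have disjoint supports, so that of [d] misses [U]. *)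
Lemma act_quot_bump g d e t :
  X g -> used d g -> ~ E d -> supt d t -> act (quot g E, e) t = act (g, e) t.
Proof.
  intros Xg Ud Ed Sd. destruct (classic (g = f)) as [-> | N]; [|now rewrite quot_other].
  apply act_quot_out; auto. intros (a & Ea & Sa). apply Ed.
  replace d with a; auto. apply (used_unique a d f t); auto. now apply HE.
Qed.

(** * Feet, fundamental domains and the motion of the block [J] *)

Lemma usedX_bij c : usedX X c -> bij c.
Proof. intros (g & _ & Ug). now apply used_bij in Ug. Qed.

Lemma usedX_incr c : usedX X c -> incr c.
Proof. intros (g & _ & Ug). now apply used_incr in Ug. Qed.

Lemma usedX_supp c :
  usedX X c -> exists x y, supp_iv c x y /\ x < m c /\ m c < c (m c) /\ c (m c) < y.
Proof.
  intros Uc. assert (M := proj1 (proj2 Hfast) c Uc). assert (Bc := usedX_bij c Uc).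
  destruct Uc as (g & _ & Ug). destruct (used_supp c g Ug) as (x & y & L & S).
  exists x, y. assert (M1 := proj1 (S _) M).
  assert (M2 := proj1 (S _) (proj1 (supt_act c true _ Bc) M)). cbn in M2.
  assert (m c < c (m c)) by (apply Ug; exact M).
  split; auto. lra.
Qed.

Lemma foot_supt c s t : in_foot m c s t -> usedX X c -> supt c t.
Proof.
  intros (x & y & S & H) Uc. destruct (usedX_supp c Uc) as (x' & y' & S' & A).
  destruct (supp_iv_unique c x' y' x y) as [-> ->]; auto; [lra|].
  apply S. destruct s; lra.
Qed.

Lemma usedX_pos c t : usedX X c -> supt c t -> t < c t.
Proof. intros (g & _ & Ug). apply Ug. Qed.

Lemma usedX_inv_pos c t : usedX X c -> supt c t -> inv c t < t.
Proof.
  intros Uc St. assert (Bc := usedX_bij c Uc).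
  assert (P := usedX_pos c (inv c t) Uc (proj1 (supt_act c false t Bc) St)).
  now rewrite inv_r in P.
Qed.

(** Side [negb e] is the foot toward which [(c, e)] pushes: the right foot ([false]) for a positive
    letter, the left foot ([true]) for an inverse one. *)
Lemma foot_act c e t :
  usedX X c -> in_foot m c (negb e) t -> in_foot m c (negb e) (act (c, e) t).
Proof.
  intros Uc F. assert (St := foot_supt c _ t F Uc). assert (Bc := usedX_bij c Uc).
  assert (St' := proj1 (supt_act c e t Bc) St).
  destruct F as (x & y & S & H). exists x, y. split; auto.
  apply S in St'. destruct e; cbn in *.
  - assert (t < c t) by now apply usedX_pos. lra.
  - assert (inv c t < t) by now apply usedX_inv_pos. lra.
Qed.

(** The gap [[m c, c (m c))] between the feet is a fundamental domain, so a single application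
    leaves it and lands in the foot ahead. *)
Lemma foot_fundamental c e t :
  usedX X c -> m c <= t < c (m c) -> in_foot m c (negb e) (act (c, e) t).
Proof.
  intros Uc H. destruct (usedX_supp c Uc) as (x & y & S & A).
  assert (Bc := usedX_bij c Uc). assert (Ic := usedX_incr c Uc).
  assert (St : supt c t) by (apply S; lra).
  assert (St' := proj1 (supt_act c e t Bc) St). apply S in St'.
  exists x, y. split; auto. destruct e; cbn in *.
  - assert (c (m c) <= c t) by (apply incr_le; auto; lra). lra.
  - assert (inv c t < m c); [|lra].
    apply (incr_lt_cancel c); auto. rewrite inv_r by auto. lra.
Qed.

(* Words in the bumps recording the itinerary of the block J: each bump carries the
   whole current image of J into a compact part of one of its feet. *)
Inductive stack : list letter -> Prop :=
| stack_nil : stack []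
| stack_cons c e u :
    stack u -> usedX X c -> ~ E c ->
    (forall t, J t -> in_foot m c (negb e) (ev ((c, e) :: u) t)) ->
    (exists z1 z2, supt c z1 /\ supt c z2 /\
       forall t, J t -> z1 <= ev ((c, e) :: u) t <= z2) ->
    stack ((c, e) :: u).

Lemma stack_bij_incr u :
  stack u -> Forall (fun l => bij (fst l) /\ incr (fst l)) u.
Proof.
  induction 1; constructor; auto. simpl. split; [now apply usedX_bij | now apply usedX_incr].
Qed.

Lemma stack_bij u : stack u -> bij (ev u).
Proof.
  intros Su. apply ev_bij. eapply Forall_impl; [|now apply stack_bij_incr].
  now intros l [].
Qed.

(** The image of [J] under [ev u] is an interval. Meeting the support of [d] but neither foot, it is
    trapped in the gap between the feet. *)
Lemma block_fundamental u d p :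
  stack u -> usedX X d -> (forall t s, J t -> ~ in_foot m d s (ev u t)) ->
  J p -> supt d (ev u p) -> forall t, J t -> m d <= ev u t < d (m d).
Proof.
  intros Su Ud D Jp Sp t Jt. destruct (usedX_supp d Ud) as (x & y & S & A).
  assert (B := stack_bij u Su). assert (I := ev_incr u (stack_bij_incr u Su)).
  apply S in Sp.
  assert (Dl : forall r, J r -> ~ x < ev u r < m d).
  { intros r Jr C. apply (D r true Jr). exists x, y. auto. }
  assert (Dr : forall r, J r -> ~ d (m d) <= ev u r < y).
  { intros r Jr C. apply (D r false Jr). exists x, y. auto. }
  assert (Ap := Dl p Jp). assert (Bp := Dr p Jp).
  assert (At := Dl t Jt). assert (Bt := Dr t Jt).
  (* Points strictly between two points of the image belong to the image, as [ev u] is an increasing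
     bijection and [J] an interval. *)
  assert (Cvx : forall r, (ev u t < r < ev u p \/ ev u p < r < ev u t) ->
                exists r', J r' /\ ev u r' = r).
  { intros r Hr. destruct (proj2 B r) as [r' <-]. exists r'. split; auto.
    destruct Hr as [[H1 H2] | [H1 H2]]; apply (incr_lt_cancel (ev u)) in H1, H2; auto.
    - apply (HJ t r' p); auto; lra.
    - apply (HJ p r' t); auto; lra. }
  split.
  - destruct (Rle_or_lt (m d) (ev u t)); auto. exfalso.
    (* The left foot is open at [m d], so its midpoint is the test point; the right foot contains
       its own end [d (m d)]. *)
    destruct (Cvx ((x + m d) / 2)) as (r & Jr & Er); [lra|].
    apply (Dl r Jr). lra.
  - destruct (Rlt_or_le (ev u t) (d (m d))); auto. exfalso.
    destruct (Cvx (d (m d))) as (r & Jr & Er); [lra|].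
    apply (Dr r Jr). lra.
Qed.

Lemma stack_push u d e :
  stack u -> usedX X d -> ~ E d ->
  (forall t, J t -> m d <= ev u t < d (m d)) -> stack ((d, e) :: u).
Proof.
  intros Su Ud Ed H. assert (Bd := usedX_bij d Ud). assert (Id := usedX_incr d Ud).
  constructor; auto.
  - intros t Jt. cbn [ev]. apply foot_fundamental; auto.
  - destruct (usedX_supp d Ud) as (x & y & S & A).
    (* The compact part is the image of the closed fundamental domain. *)
    exists (act (d, e) (m d)), (act (d, e) (d (m d))). split; [|split].
    + apply supt_act; auto. apply S. lra.
    + apply supt_act; auto. apply S. lra.
    + intros t Jt. specialize (H t Jt). cbn [ev].
      split; apply incr_le; try lra; now apply act_incr.
Qed.

Lemma stack_repeat u c e : stack ((c, e) :: u) -> stack ((c, e) :: (c, e) :: u).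
Proof.
  intros Su. inversion Su as [|c' e' u' Su' Uc Ec F (z1 & z2 & S1 & S2 & Z)]; subst.
  assert (Bc := usedX_bij c Uc). assert (Ic := usedX_incr c Uc).
  constructor; auto.
  - intros t Jt. cbn [ev]. apply foot_act; auto. now apply F.
  - exists (act (c, e) z1), (act (c, e) z2). split; [|split].
    + now apply (proj1 (supt_act c e z1 Bc)).
    + now apply (proj1 (supt_act c e z2 Bc)).
    + intros t Jt. specialize (Z t Jt). cbn [ev] in *.
      split; apply incr_le; try apply Z; now apply act_incr.
Qed.

(** Ping-pong for one letter: it fixes the block, or the head of the stack is repeated, cancelled or
    covered by a new bump. Applying [f] to the untouched block is excluded, since [f] may act inside
    [J]; that case is absorbed into a power of [f]. *)
Lemma stack_step u g e :
  stack u -> X g -> (u = [] -> g <> f) ->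
  exists u', stack u' /\ forall t, J t ->
    act (g, e) (ev u t) = ev u' t /\ act (quot g E, e) (ev u t) = ev u' t.
Proof.
  intros Su Xg Hu. assert (Bg := X_bij g Xg).
  destruct (classic (exists p, J p /\ supt g (ev u p))) as [(p & Jp & Sp) | N].
  2: { exists u. split; auto. intros t Jt.
       assert (g (ev u t) = ev u t).
       { apply NNPP. intros C. apply N. now exists t. }
       split; [now apply act_fix | now apply act_quot_fix]. }
  destruct (orbital_bump g (ev u p)) as (d & Ud & Sdp); auto.
  assert (UXd : usedX X d) by now exists g.
  assert (Bd := usedX_bij d UXd).
  destruct (used_act d g Bg Ud) as [sg Hsg].
  assert (New : ~ E d -> (forall t s, J t -> ~ in_foot m d s (ev u t)) ->
    exists u', stack u' /\ forall t, J t ->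
      act (g, e) (ev u t) = ev u' t /\ act (quot g E, e) (ev u t) = ev u' t).
  { intros Ed D. assert (F := block_fundamental u d p Su UXd D Jp Sdp).
    exists ((d, eqb e sg) :: u). split; [now apply stack_push|].
    intros t Jt. specialize (F t Jt).
    assert (St : supt d (ev u t)).
    { destruct (usedX_supp d UXd) as (x & y & S & A). apply S. lra. }
    cbn [ev]. rewrite (act_quot_bump g d) by auto. split; now apply Hsg. }
  (* On an empty stack the block is [J] itself, which the feet of [g <> f] avoid. *)
  inversion Su as [Q | c e0 u0 Su0 Uc Ec F Z Q]; subst.
  { specialize (Hu eq_refl). apply New.
    - now apply (used_f_only d g).
    - intros t s Jt C. apply (HgJ g t); auto. now exists d, s. }
  destruct (classic (d = c)) as [-> | Ndc].
  - assert (St : forall t, J t -> supt c (ev ((c, e0) :: u0) t)).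
    { intros t Jt. apply foot_supt with (negb e0); auto. }
    assert (Eq : forall t, J t ->
      act (g, e) (ev ((c, e0) :: u0) t) = act (c, eqb e sg) (ev ((c, e0) :: u0) t) /\
      act (quot g E, e) (ev ((c, e0) :: u0) t) = act (c, eqb e sg) (ev ((c, e0) :: u0) t)).
    { intros t Jt. rewrite (act_quot_bump g c) by auto. split; apply Hsg; auto. }
    destruct (bool_dec (eqb e sg) e0) as [Q | Q].
    + rewrite Q in Eq. exists ((c, e0) :: (c, e0) :: u0).
      split; [now apply stack_repeat|]. exact Eq.
    (* The opposite letter undoes the head, so the stack is popped. *)
    + assert (Q' : eqb e sg = negb e0) by (destruct (eqb e sg), e0; auto; congruence).
      rewrite Q' in Eq. exists u0. split; auto. intros t Jt.
      destruct (Eq t Jt) as [-> ->]. cbn [ev]. rewrite act_negb by auto. auto.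
  - apply New.
    (* If [d] were in [E], the point of the block moved by [d] would lie in [J] and in a foot of
       [c]. Either [c] is used in [f] and overlaps [d], or a foot of another generator meets [J]. *)
    + intros Ed. destruct (HE d Ed) as [Udf HdJ]. destruct Uc as (g' & Xg' & Uc').
      assert (UXc : usedX X c) by now exists g'.
      destruct (classic (g' = f)) as [-> | N'].
      * apply Ndc. apply (used_unique d c f (ev ((c, e0) :: u0) p)); auto.
        apply foot_supt with (negb e0); auto.
      * apply (HgJ g' (ev ((c, e0) :: u0) p)); auto.
        exists c, (negb e0). auto.
    + intros t s Jt C. apply (proj2 (proj2 Hfast) d c s (negb e0) (ev ((c, e0) :: u0) t));
        auto.
Qed.

(* Membership in the filter of one-sided neighbourhoods of the end of b
   at which the foot contained in J sits. *)
Definition near (P : R -> Prop) : Prop :=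
  exists x y z, supp_iv b x y /\ x < z < y /\
    forall s, (if side then x < s < z else z < s < y) -> P s.

Lemma UXb : usedX X b.
Proof. now exists f. Qed.

Lemma near_and P Q : near P -> near Q -> near (fun s => P s /\ Q s).
Proof.
  intros (x & y & z & S & Hz & HP) (x' & y' & z' & S' & Hz' & HQ).
  destruct (supp_iv_unique b x y x' y') as [<- <-]; auto; [lra|].
  exists x, y, (if side then Rmin z z' else Rmax z z'). split; auto.
  destruct side.
  - assert (A1 := Rmin_l z z'). assert (A2 := Rmin_r z z').
    split; [split; [apply Rmin_glb_lt|]; lra|].
    intros s Hs. split; [apply HP | apply HQ]; lra.
  - assert (A1 := Rmax_l z z'). assert (A2 := Rmax_r z z').
    split; [split; [|apply Rmax_lub_lt]; lra|].
    intros s Hs. split; [apply HP | apply HQ]; lra.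
Qed.

Lemma near_mono (P Q : R -> Prop) : (forall s, P s -> Q s) -> near P -> near Q.
Proof.
  intros H (x & y & z & S & Hz & HP). exists x, y, z. auto.
Qed.

Lemma near_ex P : near P -> exists s, P s.
Proof.
  intros (x & y & z & S & Hz & HP).
  exists (if side then (x + z) / 2 else (z + y) / 2). apply HP. destruct side; lra.
Qed.

Lemma near_foot : near (in_foot m b side).
Proof.
  destruct (usedX_supp b UXb) as (x & y & S & A).
  exists x, y, (if side then m b else b (m b)). split; auto.
  split; [destruct side; lra|]. intros s Hs. exists x, y. split; auto.
  destruct side; lra.
Qed.

(** [f] maps the support of [b] monotonically onto itself, so the bound [z] pulls back to its
    preimage under the letter. *)
Lemma near_act e P : near P -> near (fun s => P (act (f, e) s)).
Proof.
  intros (x & y & z & S & Hz & HP). assert (Bf := X_bij f Hf).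
  assert (K := act_negb f (negb e) z Bf). rewrite negb_involutive in K.
  assert (I := act_incr (f, e) Bf (homeo_incr f (HX f Hf))).
  assert (Sw := proj1 (used_supt_act b f (negb e) z Bf Hb) (proj2 (S z) Hz)).
  apply S in Sw.
  exists x, y, (act (f, negb e) z). split; auto. split; auto.
  intros s Hs. apply HP.
  assert (Ss : supt b s) by (apply S; destruct side; lra).
  apply (proj1 (used_supt_act b f e s Bf Hb)) in Ss. apply S in Ss.
  destruct side; destruct Hs as [H1 H2].
  - apply I in H2. rewrite K in H2. lra.
  - apply I in H1. rewrite K in H1. lra.
Qed.

Lemma near_avoid z1 z2 : supt b z1 -> supt b z2 -> near (fun s => ~ z1 <= s <= z2).
Proof.
  intros S1 S2. destruct (usedX_supp b UXb) as (x & y & S & A).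
  apply S in S1, S2. exists x, y, (if side then z1 else z2). split; auto.
  split; [destruct side; lra|]. intros s Hs. destruct side; lra.
Qed.

Lemma near_iter n e P : near P -> near (fun s => P (Nat.iter n (act (f, e)) s)).
Proof.
  intros HP. revert P HP. induction n as [|n IH]; intros P HP; auto.
  cbn. apply (IH (fun r => P (act (f, e) r))). now apply near_act.
Qed.

(** An integer power of [f] is encoded as a count and a direction; a further letter lengthens it,
    shortens it, or starts afresh from count 0. *)
Lemma iter_step n e e' :
  exists n' e'', forall s,
    act (f, e) (Nat.iter n (act (f, e')) s) = Nat.iter n' (act (f, e'')) s.
Proof.
  destruct (bool_dec e e') as [-> | N]; [now exists (S n), e'|].
  assert (e = negb e') as -> by (destruct e, e'; auto; congruence).
  destruct n as [|n]; [now exists 1%nat, (negb e')|].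
  exists n, e'. intros s. cbn. apply act_negb. now apply X_bij.
Qed.

Lemma U_iter n e s : U s -> U (Nat.iter n (act (f, e)) s).
Proof. intros Us. induction n; cbn; auto. now apply (proj1 (U_act e _)). Qed.

Lemma U_J s : U s -> J s.
Proof. intros (a & Ea & Sa). now apply (HE a). Qed.

(** * Itineraries of words and triviality on [U] *)

Lemma itinerary w :
  over w -> exists n e u, stack u /\
    (forall s, U s ->
       ev w s = ev u (Nat.iter n (act (f, e)) s) /\ ev (qmap w) s = ev u s) /\
    near (fun s => ev w s = ev u (Nat.iter n (act (f, e)) s) /\
                   ev (qmap w) s = ev u (Nat.iter n (act (f, e)) s)).
Proof.
  induction 1 as [|[g e0] w Xg _ (n & e & u & Su & HU & HN)].
  { exists 0%nat, true, []. split; [constructor|]. split; [now cbn|].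
    apply near_mono with (2 := near_foot). now cbn. }
  (* Shrinking the neighbourhood keeps the iterate of [s] in the foot inside [J], where block moves
     apply. *)
  assert (Ft := near_iter n e _ near_foot).
  assert (HN' := near_and _ _ HN Ft). cbn [fst] in Xg.
  (* With an empty stack [f] only changes the exponent: its quotient ignores this on [U] but follows
     it on the support of [b], which is not in [E]. *)
  destruct (classic (u = [] /\ g = f)) as [[-> ->] | N].
  - destruct (iter_step n e0 e) as (n' & e' & K).
    exists n', e', []. split; [constructor|]. split.
    + intros s Us. destruct (HU s Us) as [H1 H2]. cbn [ev qmap map fst snd] in *.
      split; [rewrite H1; apply K|]. fold (qmap w). rewrite H2.
      now apply act_quot_in.
    + apply near_mono with (2 := HN'). intros s [[H1 H2] F].
      cbn [ev qmap map fst snd] in *. fold (qmap w). rewrite H1, H2, <- K.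
      split; auto. apply (act_quot_bump f b); auto.
      apply foot_supt with side; auto. exact UXb.
  - destruct (stack_step u g e0) as (u' & Su' & St); auto.
    exists n, e, u'. split; auto. split.
    + intros s Us. destruct (HU s Us) as [H1 H2]. cbn [ev qmap map fst snd] in *.
      fold (qmap w). rewrite H1, H2. split; apply St.
      * apply U_J. now apply U_iter.
      * now apply U_J.
    + apply near_mono with (2 := HN'). intros s [[H1 H2] F].
      cbn [ev qmap map fst snd] in *. fold (qmap w). rewrite H1, H2.
      split; apply St; auto.
Qed.

(** The orbit of a moved point under an increasing map is strictly monotone. *)
Lemma iter_moves n e s : supt f s -> Nat.iter (S n) (act (f, e)) s <> s.
Proof.
  intros Sf. assert (Bf := X_bij f Hf).
  assert (I := act_incr (f, e) Bf (homeo_incr f (HX f Hf))).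
  set (k := act (f, e)) in *.
  assert (M : supt k s) by exact (proj1 (supt_inv f e s Bf) Sf).
  clearbody k.
  assert (Lt : s < k s -> s < Nat.iter (S n) k s).
  { intros L. induction n as [|n IH]; [exact L|].
    apply I in IH. cbn in *. lra. }
  assert (Gt : k s < s -> Nat.iter (S n) k s < s).
  { clear Lt. intros L. induction n as [|n IH]; [exact L|].
    apply I in IH. cbn in *. lra. }
  destruct (Rtotal_order s (k s)) as [L | [L | L]].
  - specialize (Lt L). lra.
  - now symmetry in L.
  - specialize (Gt L). lra.
Qed.

Lemma trivial_word_fixes_U w :
  over w -> (forall t, ev w t = t) \/ (forall t, ev (qmap w) t = t) ->
  forall s, U s -> ev w s = s /\ ev (qmap w) s = s.
Proof.
  intros Ow T. destruct (itinerary w Ow) as (n & e & u & Su & HU & HN).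
  assert (HN' : near (fun s => s = ev u (Nat.iter n (act (f, e)) s))).
  { apply near_mono with (2 := HN). intros s [H1 H2].
    destruct T as [T | T]; rewrite T in *; auto. }
  clear HN. assert (HN := near_and _ _ HN' near_foot).
  assert (HN2 := near_and _ _ HN (near_iter n e _ near_foot)). clear HN HN'.
  inversion Su as [Q | c e0 u0 Su0 Uc Ec F (z1 & z2 & S1 & S2 & Z) Q]; subst.
  - destruct n as [|n].
    + intros s Us. now apply HU in Us.
    (* Empty stack, nonzero exponent: [s] would be fixed by a nontrivial power of [f], yet it lies
       in the support of [b]. *)
    + exfalso. destruct (near_ex _ HN2) as (s & [Es Fs] & _).
      apply (iter_moves n e s); [|now symmetry].
      apply (used_supt b f); auto; [now apply X_bij|].
      apply foot_supt with side; auto. exact UXb.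
  - exfalso. destruct (classic (c = b)) as [-> | Ncb].
    (* If [b] is the head, the block sits in a compact part of its support, while [s] can be taken
       closer to the end. *)
    + destruct (near_ex _ (near_and _ _ HN2 (near_avoid z1 z2 S1 S2)))
        as (s & ([Es Fs] & Fs') & Av).
      apply Av. rewrite Es. apply Z. now apply HbJ.
    (* Otherwise [s] would lie in feet of two distinct bumps. *)
    + destruct (near_ex _ HN2) as (s & [Es Fs] & Fs').
      apply (proj2 (proj2 Hfast) c b (negb e0) side s); auto; [exact UXb|].
      split; auto. rewrite Es. apply F. now apply HbJ.
Qed.

(** * From words to the generated groups *)

Lemma over_bij w : over w -> bij_letters w.
Proof. apply Forall_impl. intros l. apply X_bij. Qed.

Lemma qmap_bij w : over w -> bij_letters (qmap w).
Proof.
  intros H. apply Forall_map. eapply Forall_impl; [|exact H].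
  intros l Hl. now apply quot_bij.
Qed.

Lemma over_winv w : over w -> over (winv w).
Proof. apply Forall_winv. Qed.

Lemma over_app v w : over v -> over w -> over (v ++ w).
Proof. intros. now apply Forall_app. Qed.

Lemma qmap_app v w : qmap (v ++ w) = qmap v ++ qmap w.
Proof. apply map_app. Qed.

Lemma qmap_winv w : qmap (winv w) = winv (qmap w).
Proof. unfold qmap, winv. now rewrite map_rev, !map_map. Qed.

Lemma trivial_word w :
  over w -> (forall t, ev w t = t) <-> (forall t, ev (qmap w) t = t).
Proof.
  intros Ow.
  (* Conjugates of a trivial word are trivial, so fixing [U] spreads to every translate of [U], in
     both groups. *)
  assert (Cj : forall v, over v ->
    (forall t, ev w t = t) \/ (forall t, ev (qmap w) t = t) ->
    forall s, U s -> ev w (ev v s) = ev v s /\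
      ev (qmap w) (ev (qmap v) s) = ev (qmap v) s).
  { intros v Ov T s Us.
    assert (Bv := over_bij v Ov). assert (Bqv := qmap_bij v Ov).
    destruct (trivial_word_fixes_U (winv v ++ w ++ v)) with (s := s) as [H1 H2]; auto.
    - apply over_app; [now apply over_winv | now apply over_app].
    - destruct T as [T | T]; [left | right]; intros t.
      + rewrite !ev_app, T. now apply ev_winv_l.
      + rewrite !qmap_app, !ev_app, T, qmap_winv. now apply ev_winv_l.
    - rewrite !ev_app in H1. rewrite !qmap_app, !ev_app, qmap_winv in H2.
      split.
      + rewrite <- (ev_winv_r v (ev w (ev v s)) Bv). now rewrite H1.
      + rewrite <- (ev_winv_r (qmap v) (ev (qmap w) (ev (qmap v) s)) Bqv). now rewrite H2. }
  split; intros T p.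
  - destruct (classic (exists v, over v /\ U (ev (qmap v) p))) as [(v & Ov & Uv) | N].
    + destruct (Cj (winv v) (over_winv v Ov) (or_introl T) _ Uv) as [_ H].
      rewrite qmap_winv, ev_winv_l in H; auto. now apply qmap_bij.
    (* The orbit of [p] avoids [U], so every letter agrees with its quotient along it. *)
    + rewrite <- (T p) at 2. clear T Cj.
      induction Ow as [|[g e] v Xg Ov IH]; auto. cbn [qmap map ev fst snd] in *.
      fold (qmap v). rewrite act_quot_out, IH; auto.
      intros C. apply N. now exists v.
  - destruct (classic (exists v, over v /\ U (ev v p))) as [(v & Ov & Uv) | N].
    + destruct (Cj (winv v) (over_winv v Ov) (or_intror T) _ Uv) as [H _].
      rewrite ev_winv_l in H; auto. now apply over_bij.
    + rewrite <- (T p) at 2. clear T Cj.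
      induction Ow as [|[g e] v Xg Ov IH]; auto. cbn [qmap map ev fst snd] in *.
      fold (qmap v). rewrite <- IH, act_quot_out; auto.
      intros C. apply N. now exists v.
Qed.

(** Reduces to triviality of [winv v ++ w]. One direction makes the extended map well defined, the
    other makes it injective. *)
Lemma ev_qmap_eq v w : over v -> over w -> ev v = ev w <-> ev (qmap v) = ev (qmap w).
Proof.
  intros Ov Ow.
  assert (G : forall v w, bij_letters v -> bij_letters w ->
            ev v = ev w <-> forall t, ev (winv v ++ w) t = t).
  { intros v' w' Bv Bw. split.
    - intros e t. rewrite ev_app, <- e. now apply ev_winv_l.
    - intros H. extensionality t. rewrite <- (ev_winv_r v' (ev w' t) Bv).
      now rewrite <- (ev_app (winv v') w'), H. }
  rewrite (G v w), (G (qmap v) (qmap w)) by (auto using over_bij, qmap_bij).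
  rewrite <- qmap_winv, <- qmap_app. apply trivial_word.
  apply over_app; auto. now apply over_winv.
Qed.

Lemma quotset_bij h : quotset X E h -> bij h.
Proof. intros (g & Xg & ->). now apply quot_bij. Qed.

Lemma over_quotset w :
  Forall (fun l => quotset X E (fst l)) w -> exists v, over v /\ w = qmap v.
Proof.
  induction 1 as [|[h e] w (g & Xg & Eh) _ (v & Ov & ->)].
  - exists []. split; auto. constructor.
  - cbn in Eh. subst h. exists ((g, e) :: v). split; auto. constructor; auto.
Qed.

Lemma excision :
  exists phi : (R -> R) -> (R -> R),
    (forall g, X g -> phi g = quot g E) /\
    (forall f, gen X f -> gen (quotset X E) (phi f)) /\
    (forall f g, gen X f -> gen X g -> phi (mul f g) = mul (phi f) (phi g)) /\
    (forall f g, gen X f -> gen X g -> phi f = phi g -> f = g) /\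
    (forall h, gen (quotset X E) h -> exists f, gen X f /\ phi f = h).
Proof.
  (* An arbitrary word for [h] is chosen; its quotient has a value independent of the choice when
     [h] is in [gen X]. *)
  set (phi := fun h => ev (qmap (epsilon (inhabits []) (fun w => over w /\ ev w = h)))).
  assert (W : forall h, gen X h <-> exists w, over w /\ ev w = h) by (apply gen_words, X_bij).
  assert (P : forall w, over w -> phi (ev w) = ev (qmap w)).
  { intros w Ow. unfold phi.
    destruct (epsilon_spec (inhabits []) (fun v => over v /\ ev v = ev w)) as [Ov Ev].
    - now exists w.
    - exact (proj1 (ev_qmap_eq _ w Ov Ow) Ev). }
  exists phi. split; [|split; [|split; [|split]]].
  - intros g Xg. apply (P [(g, true)]). repeat constructor. exact Xg.
  - intros h (w & Ow & <-)%W. rewrite P by auto.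
    apply (gen_words (quotset X E) quotset_bij). exists (qmap w). split; auto.
    apply Forall_map. eapply Forall_impl; [|exact Ow]. intros l Hl. now exists (fst l).
  - intros h k (w & Ow & <-)%W (v & Ov & <-)%W. rewrite !P by auto.
    assert (K : mul (ev w) (ev v) = ev (v ++ w)).
    { extensionality t. symmetry. apply ev_app. }
    rewrite K, P by now apply over_app.
    rewrite qmap_app. extensionality t. apply ev_app.
  - intros h k (w & Ow & <-)%W (v & Ov & <-)%W. rewrite !P by auto.
    apply (proj2 (ev_qmap_eq w v Ow Ov)).
  - intros h (w & Hw & <-)%(gen_words (quotset X E) quotset_bij).
    apply over_quotset in Hw. destruct Hw as (v & Ov & ->).
    exists (ev v). split; [apply W; now exists v | now apply P].
Qed.

End Excision.

Theorem theorem9p1 (X : (R -> R) -> Prop) (m : (R -> R) -> R)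
    (E : (R -> R) -> Prop) (J : R -> Prop) :
  (forall f, X f -> homeo f) ->
  geom_fast X m ->
  extraneous X m E J ->
  exists phi : (R -> R) -> (R -> R),
    (forall g, X g -> phi g = quot g E) /\
    (forall f, gen X f -> gen (quotset X E) (phi f)) /\
    (forall f g, gen X f -> gen X g -> phi (mul f g) = mul (phi f) (phi g)) /\
    (forall f g, gen X f -> gen X g -> phi f = phi g -> f = g) /\
    (forall h, gen (quotset X E) h -> exists f, gen X f /\ phi f = h).
Proof.
  intros HX Hfast (HJ & _ & f & Hf & HE & (b & Hb & HbE & side & HbJ) & HgJ).
  apply (excision X m E J f b side); auto.
  intros a Ea. destruct (HE a Ea) as (_ & Ua & Sa). auto.
Qed.
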